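(* For all integers $n,d,h,k\ge0$ with $(n,k,h,d)\ne(0,0,1,1)$, \[ p_n^{(\mathrm{pk},\mathrm{dp},\mathrm{des})}(k,h,d)+p_n^{(\mathrm{pk},\mathrm{dp},\mathrm{des})}(k,h-1,d-1)=\sum_{i,j}\binom{n}{2i+h}\, b_{2i+h}^{(\mathrm{pk},\mathrm{des})}(j,i)\, b_{n-2i-h}^{(\mathrm{pk},\mathrm{des})}(k-j,\,d-i-h), \] the sum over all integers $i,j$. Equivalently, as formal power series, \[ B^{(\mathrm{pk},\mathrm{des})}\Big(xzt,\,y,\,\tfrac{1}{z^2t}\Big)\,B^{(\mathrm{pk},\mathrm{des})}(x,y,t)=(1+zt)\,P^{(\mathrm{pk},\mathrm{dp},\mathrm{des})}(x,y,z,t)-zt. \]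
   Context: For a permutation (or word of distinct integers) $\pi=\pi_1\cdots\pi_n$, $\operatorname{des}(\pi)$ is the number of $1\le i\le n-1$ with $\pi_i>\pi_{i+1}$, $\operatorname{asc}(\pi)$ the number with $\pi_i<\pi_{i+1}$, and $\operatorname{pk}(\pi)$ the number of $2\le i\le n-1$ with $\pi_{i-1}<\pi_i>\pi_{i+1}$. Let $h(\pi)=\operatorname{asc}(\pi)-\operatorname{des}(\pi)$ and $\operatorname{dp}(\pi)=-\min\{h(\pi_1\cdots\pi_i):1\le i\le n\}$ (the depth), with $\operatorname{dp}(\epsilon)=0$ for the empty permutation. A ballot permutation is one with $h(\pi_1\cdots\pi_i)\ge0$ for all $i$; $\mathscr B_n$ is the set of ballot permutations of $[n]$, $\mathscr B_0=\mathcal S_0=\{\epsilon\}$ (all statistics of $\epsilon$ are $0$). Define $p_n^{(\mathrm{pk},\mathrm{dp},\mathrm{des})}(k,h,d)=|\{\pi\in\mathcal S_n:\operatorname{pk}(\pi)=k,\operatorname{dp}(\pi)=h,\operatorname{des}(\pi)=d\}|$ and $b_n^{(\mathrm{pk},\mathrm{des})}(k,d)=|\{\pi\in\mathscr B_n:\operatorname{pk}(\pi)=k,\operatorname{des}(\pi)=d\}|$, both $0$ if any argument is negative; $\binom{n}{m}=0$ unless $0\le m\le n$. Generating functions: $P^{(\mathrm{pk},\mathrm{dp},\mathrm{des})}(x,y,z,t)=\sum_{n\ge0}\sum_{\pi\in\mathcal S_n}y^{\operatorname{pk}(\pi)}z^{\operatorname{dp}(\pi)}t^{\operatorname{des}(\pi)}\frac{x^n}{n!}$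 and $B^{(\mathrm{pk},\mathrm{des})}(x,y,t)=\sum_{n\ge0}\sum_{\pi\in\mathscr B_n}y^{\operatorname{pk}(\pi)}t^{\operatorname{des}(\pi)}\frac{x^n}{n!}$. *)

(* Defs.v *)
From mathcomp Require Import all_boot all_order all_algebra all_fingroup.
Set Implicit Arguments. Unset Strict Implicit. Unset Printing Implicit Defensive.
Import Order.TTheory GRing.Theory Num.Theory.
Local Open Scope ring_scope.

(* A permutation pi of [n] is represented by s : 'S_n; its one-line word is
   [seq s i | i <- enum 'I_n], with values 0..n-1 (all statistics below only
   depend on the relative order of letters). *)
Definition word n (s : 'S_n) : seq nat := [seq val (s i) | i <- enum 'I_n].

Definition des (w : seq nat) : nat :=
  (\sum_(0 <= i < (size w).-1) (nth 0 w i.+1 < nth 0 w i))%N.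
Definition asc (w : seq nat) : nat :=
  (\sum_(0 <= i < (size w).-1) (nth 0 w i < nth 0 w i.+1))%N.
Definition pk (w : seq nat) : nat :=
  (\sum_(1 <= i < (size w).-1)
     ((nth 0 w i.-1 < nth 0 w i) && (nth 0 w i.+1 < nth 0 w i)))%N.

Definition hgt (w : seq nat) : int := (asc w)%:Z - (des w)%:Z.

Definition dp (w : seq nat) : int :=
  if w is [::] then 0%R
  else (- \big[Order.min/hgt (take 1 w)]_(1 <= i < (size w).+1) hgt (take i w))%R.

Definition ballot (w : seq nat) : bool :=
  [forall i : 'I_(size w), (0 <= hgt (take i.+1 w))%R].

(* p_n(k,h,d) and b_n(k,d), with all arguments integers; 0 if n < 0
   (negative k,h,d automatically give 0 since the statistics are >= 0). *)
Definition pcount (n k h d : int) : nat :=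
  if n is Posz m then
    #|[set s : 'S_m | ((pk (word s))%:Z == k) && (dp (word s) == h)
                      && ((des (word s))%:Z == d)]|
  else 0%N.

Definition bcount (n k d : int) : nat :=
  if n is Posz m then
    #|[set s : 'S_m | ballot (word s) && ((pk (word s))%:Z == k)
                      && ((des (word s))%:Z == d)]|
  else 0%N.

Definition binz (n m : int) : nat :=
  if ((0 <= m) && (m <= n))%R then 'C(absz n, absz m) else 0%N.

(* Main.v *)
(* For h > 0, read a permutation as a lattice path whose height after its first i letters
   is h(pi_1 ... pi_i), and cut it after a prefix whose end is its lowest point
   and whose remaining suffix is ballot.  Reversing the prefix makes it ballot
   too, and no peak sits next to the cut.  If the end of the prefix has height
   1 - h, the step across the cut is either a descent, and then the path has
   depth h and is cut just before its first visit to height -h; or an ascent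
   (or the end of the path), and then the depth is h - 1 and the cut is at the
   last visit to height 1 - h.  For h = 0 only the empty
   prefix occurs.  A prefix with i ascents and final height 1 - h has
   length 2i + h, and the words with a prescribed shape of prefix and suffix
   are counted by the binomial coefficient. *)
Require Import Defs.
From mathcomp Require Import all_boot all_order all_algebra all_fingroup zify.
Import Order.TTheory GRing.Theory Num.Theory.

Set Implicit Arguments.
Unset Strict Implicit.
Unset Printing Implicit Defensive.

(** * Ascents, descents and peaks under reversal, truncation and splitting *)

Lemma des_rev w : des (rev w) = asc w.
Proof.
rewrite /des /asc size_rev big_nat_rev /=.
by apply: eq_big_nat => i hi; rewrite !nth_rev;
  [congr (nat_of_bool (nth _ _ _ < nth _ _ _)%N) | |]; lia.
Qed.

Lemma asc_rev w : asc (rev w) = des w.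
Proof. by rewrite -des_rev revK. Qed.

Lemma hgt_rev w : hgt (rev w) = (- hgt w)%R.
Proof. by rewrite /hgt des_rev asc_rev opprB. Qed.

Lemma pk_rev w : pk (rev w) = pk w.
Proof.
rewrite /pk size_rev big_nat_rev /=; apply: eq_big_nat => i hi.
rewrite andbC !nth_rev; try lia.
by congr (nat_of_bool ((nth _ _ _ < nth _ _ _)%N && (nth _ _ _ < nth _ _ _)%N)); lia.
Qed.

Lemma asc_add_des (w : seq nat) : uniq w -> (asc w + des w = (size w).-1)%N.
Proof.
move=> uw; rewrite /asc /des -big_split /= -[RHS](subn0) -[RHS]muln1 -sum_nat_const_nat.
apply: eq_big_nat => i hi.
have [hi1 hi2] : (i < size w)%N /\ (i.+1 < size w)%N by lia.
have : nth 0%N w i != nth 0%N w i.+1 by rewrite nth_uniq // neq_ltn ltnSn.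
by case: ltngtP.
Qed.

Lemma asc_add_des_take (w : seq nat) m : uniq w -> (m <= size w)%N ->
  (asc (take m w) + des (take m w) = m.-1)%N.
Proof. by move=> uw hm; rewrite asc_add_des ?size_takel ?take_uniq. Qed.

Lemma des_take w m : (m <= size w)%N ->
  des (take m w) = (\sum_(0 <= i < m.-1) (nth 0 w i.+1 < nth 0 w i))%N.
Proof.
move=> hm; rewrite /des size_takel //; apply: eq_big_nat => i hi.
by rewrite !nth_take //; lia.
Qed.

Lemma des_drop w m :
  des (drop m w) = (\sum_(m <= i < (size w).-1) (nth 0 w i.+1 < nth 0 w i))%N.
Proof.
rewrite /des size_drop -[m in RHS]add0n big_addn.
have -> : ((size w - m).-1 = (size w).-1 - m)%N by lia.
by apply: eq_bigr => i _; rewrite !nth_drop addnS addnC.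
Qed.

Lemma pk_take w m : (m <= size w)%N ->
  pk (take m w) = (\sum_(1 <= i < m.-1)
    ((nth 0 w i.-1 < nth 0 w i) && (nth 0 w i.+1 < nth 0 w i)))%N.
Proof.
move=> hm; rewrite /pk size_takel //; apply: eq_big_nat => i hi.
by rewrite !nth_take //; lia.
Qed.

Lemma pk_drop w m :
  pk (drop m w) = (\sum_(m.+1 <= i < (size w).-1)
    ((nth 0 w i.-1 < nth 0 w i) && (nth 0 w i.+1 < nth 0 w i)))%N.
Proof.
rewrite /pk size_drop -[m.+1 in RHS]add1n big_addn.
have -> : ((size w - m).-1 = (size w).-1 - m)%N by lia.
apply: eq_big_nat => i hi; rewrite !nth_drop.
by congr (nat_of_bool ((nth _ _ _ < nth _ _ _)%N && (nth _ _ _ < nth _ _ _)%N)); lia.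
Qed.

(* The two pieces share the letter of index [c]. *)
Lemma des_split w c : (c < size w)%N ->
  des w = (des (take c.+1 w) + des (drop c w))%N.
Proof.
move=> hc; rewrite des_take // des_drop /des /=.
by rewrite (big_cat_nat (n := c)) //=; lia.
Qed.

Lemma asc_split w c : (c < size w)%N ->
  asc w = (asc (take c.+1 w) + asc (drop c w))%N.
Proof.
move=> hc; rewrite -!des_rev (@des_split _ ((size w).-1 - c)%N) ?size_rev; last by lia.
rewrite take_rev drop_rev addnC.
by congr (des (rev (take _ w)) + des (rev (drop _ w)))%N; lia.
Qed.

(** * Heights of prefixes, ballot words and depth *)

Lemma hgt_split w c : (c < size w)%N ->
  hgt w = (hgt (take c.+1 w) + hgt (drop c w))%R.
Proof. by move=> hc; rewrite /hgt (des_split hc) (asc_split hc); lia. Qed.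

Lemma hgt_drop_take w c l : (c <= l < size w)%N ->
  hgt (drop c (take l.+1 w)) = (hgt (take l.+1 w) - hgt (take c.+1 w))%R.
Proof.
move=> hcl; rewrite [X in (_ = X - _)%R](@hgt_split _ c) ?size_takel //; try lia.
by rewrite take_takel //; lia.
Qed.

Lemma hgt_take1 w : hgt (take 1 w) = 0%R.
Proof. by case: w => [|x w]; rewrite /hgt /asc /des /= ?take0 /= !big_geq. Qed.

Lemma hgt_step (w : seq nat) l : uniq w -> (l.+1 < size w)%N ->
  hgt (take l.+2 w) =
  (hgt (take l.+1 w) + (if (nth 0 w l.+1 < nth 0 w l)%N then -1 else 1))%R.
Proof.
move=> uw hl; apply/eqP; rewrite addrC -subr_eq -hgt_drop_take; last by lia.
have : nth 0%N w l != nth 0%N w l.+1 by rewrite nth_uniq ?neq_ltn ?ltnSn //; apply: ltnW.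
rewrite /hgt /asc /des size_drop size_takel // (_ : (l.+2 - l).-1 = 1%N); last by lia.
rewrite !big_nat1 !nth_drop addn0 addn1 !nth_take //.
by case: (ltngtP (nth _ _ _)).
Qed.

Lemma ballotP w :
  reflect (forall l, (l < size w)%N -> (0 <= hgt (take l.+1 w))%R) (ballot w).
Proof.
apply: (iffP forallP) => [H l hl | H i]; last exact: H.
exact: (H (Ordinal hl)).
Qed.

Lemma ballot_dropP w c :
  reflect (forall l, (c <= l < size w)%N ->
             (hgt (take c.+1 w) <= hgt (take l.+1 w))%R)
          (ballot (drop c w)).
Proof.
have E l : (c <= l < size w)%N -> hgt (take (l - c).+1 (drop c w)) =
    (hgt (take l.+1 w) - hgt (take c.+1 w))%R.
  move=> hl; rewrite take_drop -hgt_drop_take //.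
  by congr (hgt (drop c (take _ w))); lia.
apply: (iffP (ballotP _)) => [H l hl | H l].
  by rewrite -subr_ge0 -E //; apply: H; rewrite size_drop; lia.
rewrite size_drop => hl; have := H (c + l)%N; have := E (c + l)%N.
by rewrite (_ : (c + l - c)%N = l); lia.
Qed.

(** Reversal negates heights, so the heights along the reversed prefix measure how far earlier
    points lie above its end; ballot means that this end is a lowest point. *)
Lemma ballot_rev_takeP w c : (c < size w)%N ->
  reflect (forall l, (l <= c)%N -> (hgt (take c.+1 w) <= hgt (take l.+1 w))%R)
          (ballot (rev (take c.+1 w))).
Proof.
move=> hc.
have E l : (l <= c)%N -> hgt (take (c - l).+1 (rev (take c.+1 w))) =
    (hgt (take l.+1 w) - hgt (take c.+1 w))%R.
  move=> hl; rewrite take_rev hgt_rev size_takel //.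
  rewrite (_ : (c.+1 - (c - l).+1)%N = l); last by lia.
  by rewrite hgt_drop_take ?opprB //; lia.
apply: (iffP (ballotP _)) => [H l hl | H l].
  by rewrite -subr_ge0 -E //; apply: H; rewrite size_rev size_takel; lia.
rewrite size_rev size_takel // => hl; have := H (c - l)%N; have := E (c - l)%N.
by rewrite (_ : (c - (c - l))%N = l); lia.
Qed.

Lemma dpP w (e : int) : (0 < size w)%N ->
  reflect ((exists2 l, (l < size w)%N & hgt (take l.+1 w) = (- e)%R) /\
           (forall l, (l < size w)%N -> (- e <= hgt (take l.+1 w))%R))
          (dp w == e).
Proof.
move=> hw.
have -> : dp w = (- \big[Order.min/hgt (take 1 w)]_(1 <= i < (size w).+1) hgt (take i w))%R.
  by case: w hw.
set M := (\big[_/_]_(_ <= _ < _) _).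
have lb l : (l < size w)%N -> (M <= hgt (take l.+1 w))%R.
  by move=> hl; apply: (ge_bigmin_seq _ l.+1 xpredT (fun i => hgt (take i w)));
    rewrite ?mem_index_iota //; lia.
have at_ : exists2 l, (l < size w)%N & hgt (take l.+1 w) = M.
  rewrite /M big_nat; elim/big_ind: _ => [|x y [l hl <-] [m hm <-]|[//|i] hi].
  (* The default value of the minimum is the height after one letter, attained at index [0]. *)
  - by exists 0%N.
  - by rewrite minEle; case: ifP => _; [exists l | exists m].
  - by exists i.
apply: (iffP eqP) => [<-|[[l hl El] H]].
  by rewrite opprK; split.
case: at_ => m hm Em.
have := H m hm; have := lb l hl; lia.
Qed.

(** * Cuts at a lowest point and their relation to the depth *)

(* [c] is the index of the last letter of the prefix; [c.+1 = size w] (no letter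
   after the cut) counts as an ascent. *)
Definition join_des (w : seq nat) c := (c.+1 < size w)%N && (nth 0 w c.+1 < nth 0 w c)%N.

(** The parameter [e] stands for [h - 1], and the prefix has [c.+1] letters; [h = 0] is treated
    without cuts. *)
Definition cut_at (w : seq nat) (e c : nat) :=
  [&& (c < size w)%N, hgt (take c.+1 w) == (- e%:Z)%R,
      ballot (rev (take c.+1 w)) & ballot (drop c.+1 w)].

Lemma cut_atP (w : seq nat) e c :
  reflect [/\ (c < size w)%N, hgt (take c.+1 w) = (- e%:Z)%R,
              forall l, (l <= c)%N -> (- e%:Z <= hgt (take l.+1 w))%R &
              forall l, (c < l < size w)%N -> (hgt (take c.+2 w) <= hgt (take l.+1 w))%R]
          (cut_at w e c).
Proof.
apply: (iffP and4P) => [[hc /eqP E /(ballot_rev_takeP hc) H1 /ballot_dropP H2]|[hc E H1 H2]].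
  by split=> // l hl; rewrite -E; apply: H1.
split=> //; [exact/eqP| apply/(ballot_rev_takeP hc) | exact/ballot_dropP].
by rewrite E.
Qed.

Lemma hgt_join (w : seq nat) c : uniq w -> (c.+1 < size w)%N ->
  hgt (take c.+2 w) = (hgt (take c.+1 w) + (if join_des w c then -1 else 1))%R.
Proof. by move=> uw hc; rewrite /join_des hc; apply: hgt_step. Qed.

(** For cuts [c < c'], the height one letter after [c] is at most [-e] by the suffix at [c] and at
    least [-e] by the prefix at [c'], yet a single step from [-e] changes the height by one. *)
Lemma cut_at_inj (w : seq nat) e b c c' : uniq w ->
  cut_at w e c -> cut_at w e c' -> join_des w c = b -> join_des w c' = b -> c = c'.
Proof.
move=> uw; wlog lt : c c' / (c < c')%N.
  by case: (ltngtP c c') => // lt H *; [|symmetry]; apply: H.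
move=> /cut_atP[hc E L R] /cut_atP[hc' E' L' R'] jc jc'.
have hc1 : (c.+1 < size w)%N by apply: leq_ltn_trans hc'.
have := hgt_join uw hc1; have := L' c.+1 lt; have := R c'.
rewrite lt hc' jc E E' => /(_ isT).
by case: b {jc jc'} => /=; lia.
Qed.

Lemma dp_cut_des (w : seq nat) e : uniq w -> (0 < size w)%N ->
  (exists2 c, cut_at w e c & join_des w c) <-> (dp w == (e.+1)%:Z)%R.
Proof.
move=> uw w0; split=> [[c /cut_atP[hc E L R] jc] | /(dpP _ w0)[[l0 hl0 El0] lb]].
  have hc1 : (c.+1 < size w)%N by case/andP: jc.
  have Ec := hgt_join uw hc1; rewrite jc E /= in Ec.
  apply/dpP => //; split=> [|l hl]; first by exists c.+1; lia.
  by case: (leqP l c) => hlc; [have := L l hlc | have := R l]; lia.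
pose P l := (l < size w)%N && (hgt (take l.+1 w) == (- (e.+1)%:Z)%R).
have exP : exists l, P l by exists l0; rewrite /P hl0 El0 eqxx.
(* The first visit to height [-(e+1)] is not at the first letter, where the height is 0; the cut is
   one letter earlier. *)
case: (ex_minnP exP) => [[|c] /andP[hc /eqP Ec] minc].
  by move: Ec; rewrite hgt_take1; lia.
have L l : (l <= c)%N -> (- e%:Z <= hgt (take l.+1 w))%R.
  move=> hl; have hlw : (l < size w)%N by lia.
  have := lb l hlw; have : ~~ P l by apply/negP => /minc; lia.
  by rewrite /P hlw /= => /eqP; lia.
(* Heights before the first visit are at least [-e], so the step that reaches [-(e+1)] starts at
   exactly [-e]. *)
have := hgt_join uw hc; have := L c (leqnn c); rewrite Ec.
case jc : (join_des w c) => Lc Ecc; last by lia.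
exists c => //; apply/cut_atP; split=> //; [by lia | by lia |].
by move=> l /andP[_ hl]; rewrite Ec; apply: lb.
Qed.

Lemma dp_cut_asc (w : seq nat) e : uniq w -> (0 < size w)%N ->
  (exists2 c, cut_at w e c & ~~ join_des w c) <-> (dp w == e%:Z)%R.
Proof.
move=> uw w0; split=> [[c /cut_atP[hc E L R] /negbTE jc] | /(dpP _ w0)[[l0 hl0 El0] lb]].
  apply/dpP => //; split=> [|l hl]; first by exists c.
  case: (leqP l c) => hlc; first exact: L.
  have hc1 : (c.+1 < size w)%N by lia.
  have := hgt_join uw hc1; rewrite jc E; have := R l; lia.
pose P l := (l < size w)%N && (hgt (take l.+1 w) == (- e%:Z)%R).
have exP : exists l, P l by exists l0; rewrite /P hl0 El0 eqxx.
have ubP l : P l -> (l <= size w)%N by case/andP=> /ltnW.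
(* The cut is at the last visit to [-e]: all later heights are at least [1 - e], so the next step,
   if any, ascends. *)
case: (ex_maxnP exP ubP) => c /andP[hc /eqP Ec] maxc.
have R l : (c < l < size w)%N -> (1 - e%:Z <= hgt (take l.+1 w))%R.
  move=> /andP[hl hlw]; have := lb l hlw.
  have : ~~ P l by apply/negP => /maxc; lia.
  by rewrite /P hlw /= => /eqP; lia.
have J : (c.+1 < size w)%N -> join_des w c = false /\ hgt (take c.+2 w) = (1 - e%:Z)%R.
  move=> hc1; have := hgt_join uw hc1; have := R c.+1; rewrite Ec.
  by case: join_des; lia.
exists c.
  apply/cut_atP; split=> // l; first by move=> hl; apply: lb; lia.
  by move=> hl; have [|_ ->] := J; [lia | apply: R].
by apply/negP => jc; have [|] := J; [case/andP: jc | rewrite jc].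
Qed.

(** * Counting cuts, and the statistics across a cut *)

(** Serves for both summation indices [i] and [j], each of which has at most one contributing value
    for a given word. *)
Lemma sum_nat_pred_uniq N (Q : pred nat) :
  (forall i j, (i < N)%N -> (j < N)%N -> Q i -> Q j -> i = j) ->
  (\sum_(0 <= i < N) Q i)%N = [exists i : 'I_N, Q i] :> nat.
Proof.
move=> uQ; rewrite big_mkord; case: existsP => [[i Qi]|nQ].
  rewrite (bigD1 i) //= Qi big1 // => j ji.
  by case Qj : (Q j) => //; case/eqP: ji; apply: val_inj; apply: uQ Qj Qi.
by rewrite big1 // => i _; case Qi : (Q i) => //; case: nQ; exists i.
Qed.

(** The prefix has [c] steps and height [-e], so the index [i] of the theorem is its number of
    ascents. *)
Lemma cut_at_index (w : seq nat) e c : uniq w -> cut_at w e c ->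
  c = (2 * asc (take c.+1 w) + e)%N.
Proof.
move=> uw /cut_atP[hc E _ _].
have /= Ec := asc_add_des_take uw hc.
by move: E; rewrite /hgt; lia.
Qed.

(** Existence of a cut with a prescribed step across it is a condition on the depth; uniqueness
    makes the sum its indicator. A descent across the cut adds one to the depth. *)
Lemma sum_cut (w : seq nat) e b : uniq w -> (0 < size w)%N ->
  (\sum_(0 <= i < (size w).+1)
     (cut_at w e (2 * i + e) && (join_des w (2 * i + e) == b)))%N
  = (dp w == Posz (e + b)) :> nat.
Proof.
move=> uw w0; rewrite (@sum_nat_pred_uniq _
    (fun i => cut_at w e (2 * i + e) && (join_des w (2 * i + e) == b))); last first.
  move=> i j _ _ /andP[ci /eqP ji] /andP[cj /eqP jj].
  by have := cut_at_inj uw ci cj ji jj; lia.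
congr nat_of_bool.
have dpE : (exists2 c, cut_at w e c & join_des w c == b) <-> dp w == Posz (e + b).
  case: b; rewrite ?addn1 ?addn0 -?(dp_cut_des _ uw w0) -?(dp_cut_asc _ uw w0).
    by split=> -[c cc jc]; exists c => //; apply/eqP.
  by split=> -[c cc jc]; exists c => //; apply/eqP; case: join_des jc.
apply/existsP/idP => [[i /andP[ci ji]]|]; first by apply/dpE; exists (2 * i + e)%N.
move=> /dpE[c cc jc]; have Ec := cut_at_index uw cc.
have hi : (asc (take c.+1 w) < (size w).+1)%N by case/and4P: (cc) => hc _ _ _; lia.
by exists (Ordinal hi); rewrite -Ec cc.
Qed.

(** The step across the cut lies in neither piece and is counted separately. *)
Lemma des_cut w c : (c < size w)%N ->
  des w = (des (take c.+1 w) + des (drop c.+1 w) + join_des w c)%N.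
Proof.
move=> hc; rewrite des_take // des_drop /des /= /join_des.
rewrite (big_cat_nat (n := c)) //=; last by lia.
rewrite -addnA; congr addn; case: (ltnP c.+1 (size w)) => hc1.
  by rewrite big_ltn 1?addnC //; lia.
by rewrite !big_geq //; lia.
Qed.

(* The letters on both sides of the cut are not peaks: the last step before a
   cut is a descent, and the first step inside the suffix is an ascent. *)
Lemma pk_cut (w : seq nat) e c : uniq w -> cut_at w e c ->
  pk w = (pk (take c.+1 w) + pk (drop c.+1 w))%N.
Proof.
move=> uw /cut_atP[hc E L R]; rewrite pk_take // pk_drop /pk /=.
set K := fun i => ((nth 0 w i.-1 < nth 0 w i) && (nth 0 w i.+1 < nth 0 w i))%N.
have Kc : (0 < c)%N -> K c = false.
  case: c hc E L {R} => // c hc E L _.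
  have := hgt_join uw hc; have := L c (leqnSn c); rewrite E /K /join_des hc /=.
  by case: ifP => [D _ _|]; [apply/negbTE; rewrite negb_and -leqNgt ltnW | lia].
have Kc1 : (c.+2 < size w)%N -> K c.+1 = false.
  move=> hc2; have := hgt_join uw hc2; have := R c.+2; rewrite /K /join_des hc2 /=.
  by case: (nth _ w c.+2 < _)%N; rewrite ?andbF //; lia.
have tl : (\sum_(c.+1 <= i < (size w).-1) K i = \sum_(c.+2 <= i < (size w).-1) K i)%N.
  case: (ltnP c.+1 (size w).-1) => h; last by rewrite !big_geq; lia.
  by rewrite big_ltn // Kc1 //; lia.
rewrite -tl; case: (posnP c) => [->|c0]; first by rewrite [X in (X + _)%N]big_geq.
rewrite (big_cat_nat (n := c)) //=; last by lia.
congr addn; case: (ltnP c (size w).-1) => h; last by rewrite !big_geq; lia.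
by rewrite big_ltn // -/(K c) Kc.
Qed.

(** * The identity for a single word *)

Definition perm_stat (k h d : int) w :=
  ((pk w)%:Z == k)%R && (dp w == h) && ((des w)%:Z == d)%R.

Definition ballot_stat (k d : int) w :=
  ballot w && ((pk w)%:Z == k)%R && ((des w)%:Z == d)%R.

(** Only [j = pk u] can contribute, and it is in range once the peaks add up to [k]. *)
Lemma sum_ballot_stat (k : nat) (d d' : int) u v :
  (\sum_(0 <= j < k.+1) ballot_stat j d u * ballot_stat (k%:Z - j%:Z)%R d' v)%N =
  [&& ballot u, ballot v, (des u)%:Z == d, (des v)%:Z == d' & (pk u + pk v == k)%N]%R :> nat.
Proof.
under eq_bigr => j _ do rewrite mulnb.
rewrite (@sum_nat_pred_uniq _
  (fun j => ballot_stat j%:Z%R d u && ballot_stat (k%:Z - j%:Z)%R d' v)); last first.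
  by move=> i j _ _ /andP[/andP[/andP[_ hi] _] _] /andP[/andP[/andP[_ hj] _] _]; lia.
congr nat_of_bool; apply/existsP/and5P.
  case=> j /andP[/andP[/andP[bu hu] du] /andP[/andP[bv hv] dv]]; split=> //; lia.
case=> bu bv du dv /eqP kE; have hj : (pk u < k.+1)%N by lia.
by exists (Ordinal hj); rewrite /ballot_stat bu bv du dv /= eqxx /=; lia.
Qed.

Lemma ballot_hgt w : ballot w -> (0 <= hgt w)%R.
Proof.
case: (posnP (size w)) => [/eqP/nilP -> _|w0 /ballotP /(_ (size w).-1)].
  by rewrite /hgt /asc /des !big_geq.
by rewrite prednK // take_size leqnn; apply.
Qed.

(** The contribution of one word to the theorem: the right side looks for a position that cuts [w]
    into a reversed ballot prefix and a ballot suffix with the prescribed statistics. *)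
Lemma perm_stat_cuts (w : seq nat) (k h d : nat) : uniq w -> (size w, k, h, d) != (0, 0, 1, 1)%N ->
  (perm_stat k h d w + perm_stat k (h%:Z - 1)%R (d%:Z - 1)%R w =
   \sum_(0 <= i < (size w).+1) \sum_(0 <= j < k.+1)
     (2 * i + h <= size w) *
     (ballot_stat j i (rev (take (2 * i + h) w)) *
      ballot_stat (k%:Z - j%:Z)%R (d%:Z - i%:Z - h%:Z)%R (drop (2 * i + h) w)))%N.
Proof.
move=> uw nz.
under eq_bigr => i _ do rewrite -big_distrr /= sum_ballot_stat.
case: (posnP (size w)) => [|] w0.
  case: w w0 nz {uw} => // _ nz.
  have [pk0 des0] : pk [::] = 0%N /\ des [::] = 0%N by rewrite /pk /des !big_geq.
  have b0 : ballot [::] by apply/ballotP.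
  have [t0 d0] : take h (@nil nat) = [::] /\ drop h (@nil nat) = [::] by case: (h).
  rewrite big_nat1 muln0 add0n t0 d0 {t0 d0}.
  rewrite /perm_stat (_ : rev [::] = [::]) // b0 pk0 des0 (_ : dp [::] = 0%R) //=.
  rewrite addn0; move: nz; rewrite !xpair_eqE /=.
  (* For the empty word and [h = 1] the left side is nonzero only at [k = 0], [d = 1], the excluded
     case. *)
  by case: h => [|[|h]]; lia.
case: h nz => [|e] _.
  (* For [h = 0] the term [i = 0] has an empty prefix and asks that [w] be ballot, that is, of depth
     0. *)
  rewrite big_nat_recl // muln0 take0 drop0 big1 ?addn0 => [|i _].
    rewrite (_ : rev [::] = [::]) // (_ : ballot [::]); last by apply/ballotP.
    rewrite [pk [::]]/pk [des [::]]/des !big_geq // /perm_stat.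
    have -> : (dp w == 0)%R = ballot w.
      apply/(dpP _ w0)/ballotP => [[_ H] l /H|H]; first by rewrite oppr0.
      by split=> //; exists 0%N; rewrite // hgt_take1.
    have -> : (dp w == 0%:Z - 1)%R = false.
      apply/negbTE/negP => /(dpP _ w0)[_ /(_ 0%N w0)].
      by rewrite hgt_take1; lia.
    by rewrite andbF; lia.
  apply/eqP; rewrite addn0 muln_eq0; apply/negPn; rewrite negb_or !eqb0 !negbK.
  apply/negP => /andP[hs /and5P[]].
  (* A prefix of length [2 * i.+1] with [i.+1] ascents has [i] descents, so its reversal ends at
     height -1. *)
  move=> /ballot_hgt; rewrite hgt_rev des_rev => h0 _ d1 _ _.
  have := asc_add_des_take uw hs.
  by move: h0 d1; rewrite /hgt; lia.
(* With [h = e + 1], cuts followed by a descent account for the first term on the left, the other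
   cuts for the second. *)
transitivity (\sum_(0 <= i < (size w).+1)
    (((pk w == k) && (des w == d)) *
       (cut_at w e (2 * i + e) && (join_des w (2 * i + e) == true)) +
     ((pk w == k) && ((des w).+1 == d)) *
       (cut_at w e (2 * i + e) && (join_des w (2 * i + e) == false))))%N.
  rewrite big_split -!big_distrr /= !sum_cut // /perm_stat addn0 addn1.
  rewrite (_ : (Posz e.+1 - 1)%R = e%:Z)%R; last by lia.
  by case: (dp w == _) (dp w == _) => [] []; lia.
apply: eq_bigr => i _; rewrite addnS.
set c := (2 * i + e)%N.
case ct: (cut_at w e c); last first.
  (* A prefix of length [2i + e + 1] with [i] ascents has [i + e] descents, hence height [-e]; a
     nonzero right side would thus give a cut. *)
  rewrite !muln0; apply/esym/eqP; rewrite muln_eq0 -implyNb eqb0 negbK; apply/implyP => hc.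
  rewrite eqb0; apply/negP => /and5P[b1 b2 d1 d2 _]; move/negP: ct; apply; apply/and4P; split=> //.
  have := asc_add_des_take uw hc.
  by move: d1; rewrite /hgt des_rev /=; lia.
case/and4P: (ct) => hc /eqP hE b1 b2.
have := asc_add_des_take uw hc.
(* At a cut the prefix has [i + e] descents, so a suffix with [d - i - h] descents means that
   [des w] is [d] or [d - 1], according to the step across. *)
rewrite (pk_cut uw ct) (des_cut hc) b1 b2 hc pk_rev des_rev /=.
move: hE; rewrite /hgt.
by case: (join_des w c) => /= hE ad; lia.
Qed.

(** * Relabelling letters and standardization *)

(** The property that allows a word to be replaced by its standardization. *)
Definition order_invariant (T : Type) (F : seq nat -> T) :=
  forall (f : nat -> nat) (w : seq nat), {in w &, {mono f : x y / (x < y)%N}} -> F (map f w) = F w.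

Lemma order_invariant_asc : order_invariant asc.
Proof.
move=> f w fm; rewrite /asc size_map; apply: eq_big_nat => i hi.
have [hi1 hi2] : (i < size w)%N /\ (i.+1 < size w)%N by lia.
by rewrite !(nth_map 0%N) ?fm ?mem_nth.
Qed.

Lemma order_invariant_des : order_invariant des.
Proof.
move=> f w fm; rewrite /des size_map; apply: eq_big_nat => i hi.
have [hi1 hi2] : (i < size w)%N /\ (i.+1 < size w)%N by lia.
by rewrite !(nth_map 0%N) ?fm ?mem_nth.
Qed.

Lemma order_invariant_pk : order_invariant pk.
Proof.
move=> f w fm; rewrite /pk size_map; apply: eq_big_nat => i hi.
have [hi0 hi1 hi2] : [/\ (i.-1 < size w)%N, (i < size w)%N & (i.+1 < size w)%N] by split; lia.
by rewrite !(nth_map 0%N) ?fm ?mem_nth.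
Qed.

Lemma order_invariant_ballot : order_invariant ballot.
Proof.
move=> f w fm.
have E l : hgt (take l (map f w)) = hgt (take l w).
  have fmt : {in take l w &, {mono f : x y / (x < y)%N}}.
    by apply: sub_in2 fm => x; apply: mem_take.
  by rewrite -map_take /hgt order_invariant_asc ?order_invariant_des.
by apply/ballotP/ballotP; rewrite size_map => H l hl; [rewrite -E | rewrite E]; apply: H.
Qed.

Lemma order_invariant_ballot_stat k d : order_invariant (ballot_stat k d).
Proof.
move=> f w fm.
by rewrite /ballot_stat order_invariant_ballot ?order_invariant_pk ?order_invariant_des.
Qed.

(** Both lists are duplicate-free of the same factorial length, so one inclusion suffices. *)
Lemma perm_permutations_map (T T' : eqType) (f : T -> T') (s : seq T) :
  {in s &, injective f} -> uniq s ->
  perm_eq (permutations (map f s)) (map (map f) (permutations s)).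
Proof.
move=> finj us.
have umap : uniq (map (map f) (permutations s)).
  rewrite map_inj_in_uniq ?permutations_uniq // => u v.
  rewrite !mem_permutations => pu pv; apply: (inj_in_map finj); apply/allP => x.
    by rewrite (perm_mem pu).
  by rewrite (perm_mem pv).
have sub : {subset map (map f) (permutations s) <= permutations (map f s)}.
  by move=> _ /mapP[u + ->]; rewrite !mem_permutations; apply: perm_map.
have [|_ eqi] := uniq_min_size umap sub.
  by rewrite size_map !size_permutations ?map_inj_in_uniq // size_map.
by rewrite perm_sym; apply: uniq_perm => //; apply: permutations_uniq.
Qed.

(** The increasing relabelling that sends each rank to the letter of that rank, [nth 0 t] for the
    sorted list [t], matches the two sets of words. *)
Lemma sum_permutations_std (F : seq nat -> nat) s : order_invariant F -> uniq s ->
  (\sum_(w <- permutations s) F w = \sum_(w <- permutations (iota 0 (size s))) F w)%N.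
Proof.
move=> Finv us; set t := sort leq s.
have pts : perm_eq t s by rewrite perm_sort.
have ut : uniq t by rewrite (perm_uniq pts).
have st : sorted ltn t by rewrite ltn_sorted_uniq_leq ut sort_sorted //; apply: leq_total.
have nm : {in iota 0 (size t) &, {mono nth 0%N t : x y / (x < y)%N}}.
  move=> x y; rewrite !mem_iota /= add0n => hx hy.
  have lt := sorted_ltn_nth ltn_trans 0%N st.
  case: (ltngtP x y) => [xy|yx|->]; last by rewrite ltnn.
    by rewrite lt.
  by apply/negbTE; rewrite -leqNgt ltnW // lt.
have it : {in iota 0 (size t) &, injective (nth 0%N t)}.
  move=> x y hx hy E; have := nm x y hx hy; have := nm y x hy hx.
  by rewrite E ltnn; lia.
have <- : size t = size s by rewrite size_sort.
rewrite -(perm_big _ (perm_permutations pts)).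
rewrite -[t in permutations t](mkseq_nth 0%N) /mkseq.
rewrite (perm_big _ (perm_permutations_map it (iota_uniq _ _))) big_map.
apply: eq_big_seq => w; rewrite mem_permutations => pw; apply: Finv => x y xw yw.
by apply: nm; rewrite -(perm_mem pw).
Qed.

(** * Choosing the letters of the prefix *)

(** With the letter set of the prefix fixed, that of the suffix is its complement, and the two
    pieces are arranged independently. *)
Lemma perm_permutations_take (T : eqType) (s w : seq T) m : uniq s -> perm_eq w s ->
  perm_eq [seq x <- permutations s | perm_eq (take m w) (take m x)]
          [seq u ++ v | u <- permutations (take m w), v <- permutations (drop m w)].
Proof.
move=> us ws; have uw : uniq w by rewrite (perm_uniq ws).
apply: uniq_perm; first by rewrite filter_uniq ?permutations_uniq.
  apply: allpairs_uniq; rewrite ?permutations_uniq // => -[u v] [u' v'] /allpairsP[p [pu pv [-> ->]]].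
  move=> /allpairsP[q [qu qv [-> ->]]] /= /eqP.
  move: pu qu; rewrite !mem_permutations => /perm_size pu /perm_size qu.
  by rewrite eqseq_cat ?pu ?qu // => /andP[/eqP -> /eqP ->].
move=> x; rewrite mem_filter mem_permutations; apply/andP/allpairsP.
  move=> [tx xs]; exists (take m x, drop m x); rewrite /= !mem_permutations cat_take_drop.
  split=> //; first by rewrite perm_sym.
  have : perm_eq (take m x ++ drop m x) (take m w ++ drop m w).
    by rewrite !cat_take_drop (permPl xs) perm_sym.
  rewrite perm_sym (permPl (perm_cat tx (perm_refl _))) perm_cat2l perm_sym //.
move=> [[u v] /= []]; rewrite !mem_permutations => pu pv ->.
have su : size u = minn m (size w) by rewrite (perm_size pu) size_take_min.
have tu : take m (u ++ v) = u.
  case: (leqP m (size w)) => hm; first by apply: take_size_cat; lia.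
  have -> : v = [::] by apply/nilP; rewrite /nilp (perm_size pv) drop_oversize // ltnW.
  by rewrite cats0 take_oversize // su geq_minl.
rewrite tu perm_sym; split=> //; apply: perm_trans ws.
by rewrite -[w in perm_eq _ w](cat_take_drop m) perm_cat.
Qed.

(* Double counting of the pairs [(w, x)] of permutations whose prefixes of length
   [m] have the same letters: each [w] has [m! (n - m)!] partners. *)
Lemma sum_permutations_take_drop (F G : seq nat -> nat) n m :
  order_invariant F -> order_invariant G -> (m <= n)%N ->
  (\sum_(w <- permutations (iota 0 n)) F (take m w) * G (drop m w) =
   'C(n, m) * (\sum_(u <- permutations (iota 0 m)) F u) *
              (\sum_(v <- permutations (iota 0 (n - m))) G v))%N.
Proof.
move=> Finv Ginv hm; set S := permutations _.
pose H x := (F (take m x) * G (drop m x))%N.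
have un := iota_uniq 0 n.
have Sw w : w \in S -> [/\ perm_eq w (iota 0 n), uniq w & size w = n].
  rewrite mem_permutations => pw.
  by rewrite (perm_uniq pw) (perm_size pw) size_iota.
have h0 : (0 < m`! * (n - m)`!)%N by rewrite muln_gt0 !fact_gt0.
apply/eqP; rewrite -(eqn_pmul2r h0); apply/eqP.
(* Exchanging the sums, each [x] is counted once for every partner [w]. *)
transitivity (\sum_(w <- S) \sum_(x <- S | perm_eq (take m w) (take m x)) H x)%N.
  under [RHS]eq_bigr do rewrite big_mkcond.
  rewrite exchange_big /= big_distrl /=; apply: eq_big_seq => x /Sw[px ux sx].
  rewrite -big_mkcond big_const_seq iter_addn_0; congr muln.
  under eq_count => w do rewrite perm_sym.
  rewrite -size_filter (perm_size (perm_permutations_take _ un px)) size_allpairs.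
  by rewrite !size_permutations ?take_uniq ?drop_uniq // size_drop size_takel sx.
set bF := (\sum_(u <- _) F u)%N; set bG := (\sum_(v <- _) G v)%N.
(* For fixed [w] the inner sum factors over the two pieces, and standardization removes the
   dependence on their letters. *)
transitivity (\sum_(w <- S) bF * bG)%N.

  apply: eq_big_seq => w /Sw[pw uw sw].
  have -> : bF = (\sum_(u <- permutations (take m w)) F u)%N.
    by rewrite sum_permutations_std ?take_uniq // size_takel ?sw.
  have -> : bG = (\sum_(v <- permutations (drop m w)) G v)%N.
    by rewrite sum_permutations_std ?drop_uniq // size_drop sw.
  rewrite -big_filter (perm_big _ (perm_permutations_take _ un pw)).
  rewrite big_allpairs_dep big_distrl /=.
  apply: eq_big_seq => u; rewrite mem_permutations => /perm_size su.
  rewrite size_takel ?sw // in su.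
  rewrite big_distrr; apply: eq_bigr => v _.
  by rewrite /H take_size_cat ?drop_size_cat // su.
rewrite big_const_seq iter_addn_0 count_predT size_permutations // size_iota -(bin_fact hm).
lia.
Qed.

(** * From permutations to words, and the theorem *)

Lemma perm_word_permutations n :
  perm_eq [seq word s | s : 'S_n] (permutations (iota 0 n)).
Proof.
have winj : injective (@word n).
  move=> s t /eq_in_map E; apply/permP => i; apply/val_inj/E.
  by rewrite mem_enum.
have uws : uniq [seq word s | s : 'S_n] by rewrite map_inj_uniq ?enum_uniq.
have sub : {subset [seq word s | s : 'S_n] <= permutations (iota 0 n)}.
  move=> _ /mapP[s _ ->]; rewrite mem_permutations.
  have us : uniq (word s).
    by rewrite map_inj_uniq ?enum_uniq // => i j /val_inj /perm_inj.
  have ss : {subset word s <= iota 0 n}.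
    by move=> _ /mapP[i _ ->]; rewrite mem_iota add0n ltn_ord.
  have [|_ eqi] := uniq_min_size us ss; last by apply: uniq_perm; rewrite ?iota_uniq.
  by rewrite size_map size_iota size_enum_ord.
have [|_ eqi] := uniq_min_size uws sub; last first.
  by apply: uniq_perm; rewrite ?permutations_uniq.
by rewrite size_permutations ?iota_uniq // size_iota size_map -cardE card_Sn.
Qed.

Lemma sum_word n (F : seq nat -> nat) :
  (\sum_(s : 'S_n) F (word s) = \sum_(w <- permutations (iota 0 n)) F w)%N.
Proof. by rewrite -(perm_big _ (perm_word_permutations n)) big_image. Qed.

Lemma sum_permutations_rev (T : eqType) (F : seq T -> nat) s :
  (\sum_(w <- permutations s) F (rev w) = \sum_(w <- permutations s) F w)%N.
Proof.
rewrite -(big_map rev xpredT F); apply: perm_big; apply: uniq_perm.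
- by rewrite map_inj_uniq ?permutations_uniq //; apply: (can_inj revK).
- exact: permutations_uniq.
move=> w; rewrite -[w in LHS]revK mem_map; last exact: (can_inj revK).
by rewrite !mem_permutations perm_rev.
Qed.

Lemma order_invariant_rev (T : Type) (F : seq nat -> T) :
  order_invariant F -> order_invariant (F \o rev).
Proof.
move=> Finv f w fm; rewrite /= -map_rev Finv // => x y.
by rewrite !mem_rev; apply: fm.
Qed.

Lemma card_word n (P : pred (seq nat)) :
  (#|[set s : 'S_n | P (word s)]| = \sum_(w <- permutations (iota 0 n)) P w)%N.
Proof.
rewrite -sum1_card -(sum_word n (fun w => nat_of_bool (P w))) big_mkcond.
by apply: eq_bigr => s _; rewrite inE; case: (P _).
Qed.

(** The binomial coefficient chooses the letters of the prefix; reversing it is harmless, since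
    reversal permutes the arrangements of those letters. *)
Lemma bcount_cut (n m : nat) (k k' d d' : int) :
  (binz n m * bcount m k d * bcount (n%:Z - m%:Z)%R k' d' =
   \sum_(w <- permutations (iota 0 n))
     (m <= n) * (ballot_stat k d (rev (take m w)) * ballot_stat k' d' (drop m w)))%N.
Proof.
rewrite /binz lez_nat -big_distrr /=; case: leqP => mn; last by rewrite !mul0n.
rewrite mul1n subzn // /bcount.
rewrite (card_word m (ballot_stat k d)) (card_word (n - m) (ballot_stat k' d')).
rewrite -(sum_permutations_rev (fun w => nat_of_bool (ballot_stat k d w))).
rewrite -(@sum_permutations_take_drop (fun w => ballot_stat k d (rev w))
            (fun w => ballot_stat k' d' w)) // => f w fm; congr nat_of_bool.
  exact: (order_invariant_rev (@order_invariant_ballot_stat k d)).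
exact: order_invariant_ballot_stat.
Qed.

(** The finite ranges capture the sum over all integers: elsewhere a peak or descent count would be
    negative, or [2i + h] would exceed [n]. *)
Theorem theorem3p6 (n d h k : nat) :
  (n, k, h, d) != (0, 0, 1, 1) ->
  (pcount n k h d + pcount n k (h%:Z - 1)%R (d%:Z - 1)%R =
   \sum_(0 <= i < n.+1) \sum_(0 <= j < k.+1)
     binz n (2 * i + h)%N *
     bcount (2 * i + h)%N j i *
     bcount (n%:Z - (2 * i + h)%N%:Z)%R (k%:Z - j%:Z)%R
            (d%:Z - i%:Z - h%:Z)%R)%N.
Proof.
(* Each product becomes a sum over words, which is moved outside so that the two sides are compared
   word by word. *)
move=> nz; under eq_bigr do under eq_bigr do rewrite bcount_cut.
under eq_bigr do rewrite exchange_big /=.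
rewrite exchange_big /= /pcount.
rewrite (card_word n (perm_stat k h d)) (card_word n (perm_stat k (h%:Z - 1)%R (d%:Z - 1)%R)).
rewrite -big_split; apply: eq_big_seq => w; rewrite mem_permutations => pw.
have sw : size w = n by rewrite (perm_size pw) size_iota.
rewrite -[in RHS]sw; apply: perm_stat_cuts; last by rewrite sw.
by rewrite (perm_uniq pw) iota_uniq.
Qed.
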